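(* Let $n\ge 2$ be an integer, let $A\subseteq\mathbb{F}_{2^{n-1}}\setminus\{0\}$ with $|A|=k<2^{n-1}-4$, and let $\overline{A}^*$ be the complement of $A$ in $\mathbb{F}_{2^{n-1}}\setminus\{0\}$. Suppose $r(\overline{A}^* )>0$. Then there exists a subset of $\mathbb{F}_{2^n}\setminus\{0\}$ of size $k+3$ whose $r$-value is $r(A)$.
   Context: For a subset $X$ of a finite additive abelian group, the $r$-value $r(X)$ is the number of ordered pairs $(x,y)\in X\times X$ with $x+y\in X$. Only the additive group of $\mathbb{F}_{2^n}$ is used: its elements are written as vectors $[\alpha_1,\dots,\alpha_n]$ with $\alpha_i\in\{0,1\}$ and addition coordinatewise modulo 2. By convention $\mathbb{F}_{2^{n-1}}$ is regarded as the subset of $\mathbb{F}_{2^n}$ consisting of the vectors with first coordinate $\alpha_1=0$. *)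

(* Defs.v *)
From mathcomp Require Import all_boot all_order all_algebra.

Set Implicit Arguments.
Unset Strict Implicit.
Unset Printing Implicit Defensive.

Import GRing.Theory.
Local Open Scope ring_scope.

Definition rvalue (G : finZmodType) (X : {set G}) : nat :=
  #|[set p : G * G | [&& p.1 \in X, p.2 \in X & p.1 + p.2 \in X]]|.

(* The additive group of the field with 2 ^ n elements; the multiplication of
   the field is not used. *)
Notation F2vec n := 'rV['F_2]_n.

(* The copy of F2vec n.-1 inside F2vec n: vectors whose first coordinate (the
   one of index 0 in 'I_n) vanishes. For n = 0 there is no such coordinate and
   the condition is void. *)
Definition subF2vec (n : nat) : {set F2vec n} :=
  [set v : F2vec n | [forall i : 'I_n, (i == 0 :> nat)%N ==> (v 0 i == 0)]].

(* Main.v *)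
Require Import Defs.
From mathcomp Require Import all_boot all_order all_algebra.

Set Implicit Arguments.
Unset Strict Implicit.
Unset Printing Implicit Defensive.

Import GRing.Theory.
Local Open Scope ring_scope.

(** Let H be the hyperplane of vectors whose first coordinate is zero. Since the
    complement C of A in H minus 0 has a positive r-value, it contains x and y
    such that x + y is in C. Pick e outside H and add to A the three elements of
    S = {e, e + x, e + y} of the other coset of H. The number of elements outside
    H in a triple (u, v, u + v) is 0 or 2, so a triple in the union of A and S
    that is not in A consists of two elements of S and one of A, which is then
    the sum of two elements of S. But the sums of two elements of S are
    0, x, y and x + y, and none of them is in A. So no new triple appears
    ([rvalue_setU_odd]).

    The elements x and y are distinct because x + y is not 0, and neither of them
    is 0; hence S has exactly three elements. *)

(** The map [f] plays the part of a parity: the elements of [A] are even and those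
    of [S] are odd. A difference of elements of [S] arises when one summand is in
    [A] while the other summand and the sum are in [S]. *)
Lemma rvalue_setU_odd (G : finZmodType) (f : G -> 'F_2) (A S : {set G}) :
  {morph f : u v / u + v} ->
  {in A, forall u, f u = 0} -> {in S, forall u, f u = 1} ->
  {in S &, forall u v, u + v \notin A} ->
  {in S &, forall u v, u - v \notin A} ->
  rvalue (A :|: S) = rvalue A.
Proof.
move=> fD fA fS addS subS; congr #|pred_of_set _|; apply/setP => -[u v].
rewrite !inE /=; apply/idP/idP; last first.
  by case/and3P => -> -> ->.
case/and3P => /orP[] hu /orP[] hv /orP[] huv.
- by rewrite hu hv huv.
- by have := fS _ huv; rewrite fD (fA _ hu) (fA _ hv).
- by have := fA _ huv; rewrite fD (fA _ hu) (fS _ hv).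
- by have := subS _ _ huv hv; rewrite addrK hu.
- by have := fA _ huv; rewrite fD (fS _ hu) (fA _ hv).
- by have := subS _ _ huv hu; rewrite addrAC subrr add0r hv.
- by have := addS _ _ hu hv; rewrite huv.
- by have := fS _ huv; rewrite fD (fS _ hu) (fS _ hv).
Qed.

Lemma addvv_F2 n (v : F2vec n) : v + v = 0.
Proof. by apply/rowP => i; rewrite !mxE addrr_pchar2 // pchar_Fp. Qed.

Lemma oppv_F2 n (v : F2vec n) : - v = v.
Proof. by apply/esym/eqP; rewrite -addr_eq0 addvv_F2. Qed.

Lemma mem_subF2vec n (v : F2vec n.+1) : (v \in subF2vec n.+1) = (v 0 0 == 0).
Proof.
rewrite inE; apply/forallP/idP => [/(_ 0) // | v0 i].
by apply/implyP => /eqP i0; rewrite (_ : i = 0) //; apply: val_inj.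
Qed.

Theorem proposition4p8 (n k : nat) (A : {set F2vec n})
  (hn : (2 <= n)%N)
  (hA : A \subset subF2vec n :\ 0%R)
  (hAk : #|A| = k)
  (hk : (k < 2 ^ (n - 1) - 4)%N)
  (hr : (0 < rvalue ((subF2vec n :\ 0%R) :\: A))%N) :
  exists B : {set F2vec n},
    [/\ B \subset [set: F2vec n] :\ 0%R, #|B| = (k + 3)%N & rvalue B = rvalue A].
Proof.
case: n => [|n] // in A hn hA hAk hk hr *.
case/card_gt0P: hr => -[x y]; rewrite inE /= => /and3P[].
rewrite !in_setD !in_set1 !mem_subF2vec => /and3P[xA x0 /eqP fx].
move=> /and3P[yA y0 /eqP fy] /and3P[xyA xy0 _].
have memA u : u \in A -> u != 0 /\ u 0 0 = 0.
  by move/(subsetP hA); rewrite in_setD1 mem_subF2vec => /andP[-> /eqP].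
pose e : F2vec n.+1 := delta_mx 0 0.
(* As e + e = 0, the sums of two elements of S are those of two elements of T. *)
pose T : {set F2vec n.+1} := [set 0; x; y].
pose S : {set F2vec n.+1} := [set e + z | z in T].
have S1 : {in S, forall u : F2vec n.+1, u 0 0 = 1}.
  move=> _ /imsetP[z zT ->]; rewrite !mxE !eqxx /=.
  by move: zT; rewrite !inE => /orP[/orP[]|] /eqP->; rewrite ?fx ?fy ?mxE addr0.
have T_sum : {in T &, forall z w, z + w \notin A}.
  have zeroA : 0 \notin A by apply/negP => /memA[]; rewrite eqxx.
  move=> z w; rewrite !inE => /orP[/orP[]|] /eqP-> /orP[/orP[]|] /eqP->;
    by rewrite ?add0r ?addr0 ?addvv_F2 // addrC.
have S_sum : {in S &, forall u v, u + v \notin A}.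
  move=> _ _ /imsetP[z zT ->] /imsetP[w wT ->].
  by rewrite addrACA addvv_F2 add0r T_sum.
exists (A :|: S); split.
- apply/subsetP => u; rewrite in_setD1 in_setT andbT => /setUP[/memA[] // | /S1 u1].
  by apply: contra_eq_neq u1 => ->; rewrite mxE eq_sym oner_eq0.
- have /eqP AS0 : A :&: S == set0.
    rewrite setI_eq0; apply/pred0P => u /=; apply/negP => /andP[/memA[_ u0]].
    by move/S1; rewrite u0 => /esym/eqP; rewrite oner_eq0.
  rewrite cardsU AS0 cards0 subn0 hAk card_imset; last exact: addrI.
  have xy : x != y by apply: contraNneq xy0 => ->; rewrite addvv_F2.
  by rewrite /T setUC cardsU1 cards2 !inE negb_or y0 (eq_sym y) xy (eq_sym 0) x0.
- apply: (rvalue_setU_odd (f := fun v : F2vec n.+1 => v 0 0)) => //.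
  + by move=> u v; rewrite mxE.
  + by move=> u /memA[].
  + by move=> u v uS vS; rewrite oppv_F2 S_sum.
Qed.
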